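(* For any $\beta>0$, $N$, and $\varepsilon'\in(0,0.01\sqrt N]$, there exists a 2-local Hamiltonian on $2N$ qubits such that the sample complexity of learning its coefficients to $\ell_2$ error $\varepsilon'$ with probability at least $2/3$ is $\Omega\bigl(\frac{\exp(2\beta)}{\beta^2\varepsilon'^2}N\bigr)$.
   Context: A Hamiltonian is $H=\sum_a\lambda_aE_a$ with known terms $E_a$ (Pauli tensor products, here each acting nontrivially on at most 2 qubits, i.e. 2-local) and coefficients $\lambda_a\in[-1,1]$. Its Gibbs state at inverse temperature $\beta$ is $\rho=e^{-\beta H}/\operatorname{Tr}e^{-\beta H}$. The sample complexity of learning the coefficients to $\ell_2$ error $\varepsilon'$ with probability $\ge 2/3$ is the minimum number of independent copies of the Gibbs state needed by any procedure that knows $\beta$ and the terms and, for every admissible choice of the unknown coefficients, outputs $\hat\lambda$ with $\|\hat\lambda-\lambda\|_2\le\varepsilon'$ with probability at least $2/3$. *)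

(* Defs.v *)
From HB Require Import structures.
From mathcomp Require Import all_boot all_order all_algebra.
From mathcomp Require Import all_classical all_reals.
From mathcomp Require Import topology normedtype sequences exp.
From mathcomp Require Import complex mxtens.
Set Implicit Arguments. Unset Strict Implicit. Unset Printing Implicit Defensive.
Import Order.TTheory GRing.Theory Num.Theory numFieldNormedType.Exports.
Local Open Scope ring_scope.

Section QDefs.
Variable R : realType.
Local Notation C := (R[i]).
Local Open Scope complex_scope.

Definition adjmx (m n : nat) (A : 'M[C]_(m, n)) : 'M[C]_(n, m) :=
  \matrix_(i, j) (A j i)^*.

Definition psd (d : nat) (A : 'M[C]_d) : Prop :=
  A = adjmx A /\ forall v : 'cV[C]_d, 0 <= (adjmx v *m A *m v) 0 0.

Definition povm (d : nat) (O : finType) (M : O -> 'M[C]_d) : Prop :=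
  (forall o, psd (M o)) /\ \sum_(o : O) M o = 1%:M.

(* single-qubit Paulis: 0 = I, 1 = X, 2 = Y, 3 = Z *)
Definition pauli1 (p : 'I_4) : 'M[C]_2 :=
  \matrix_(i < 2, j < 2)
    match val p with
    | 0%N => if val i == val j then 1 else 0
    | 1%N => if val i == val j then 0 else 1
    | 2%N => if val i == val j then 0
             else if val i == 0%N then - 'i else 'i
    | _ => if val i == val j then (if val i == 0%N then 1 else -1) else 0
    end.

Definition qbit (n : nat) (k : 'I_n) (r : 'I_(2 ^ n)) : 'I_2 :=
  inord (odd (r %/ 2 ^ k)).

Definition pauli_string (n : nat) (P : {ffun 'I_n -> 'I_4}) : 'M[C]_(2 ^ n) :=
  \matrix_(r, c) \prod_(k < n) pauli1 (P k) (qbit k r) (qbit k c).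

Definition pauli_support (n : nat) (P : {ffun 'I_n -> 'I_4}) : {set 'I_n} :=
  [set k | P k != 0].

Definition hamiltonian (n m : nat) (E : 'I_m -> {ffun 'I_n -> 'I_4})
  (lam : 'I_m -> R) : 'M[C]_(2 ^ n) :=
  \sum_(a < m) (lam a)%:C *: pauli_string (E a).

Definition expmx_partial (d : nat) (A : 'M[C]_d) (K : nat) : 'M[C]_d :=
  \sum_(k < K) ((k`!)%:R)^-1 *: A ^+ k.

Definition expmx (d : nat) (A : 'M[C]_d) : 'M[C]_d :=
  \matrix_(i, j) Complex (limn (fun K => complex.Re (expmx_partial A K i j)))
                         (limn (fun K => complex.Im (expmx_partial A K i j))).

Definition gibbs (d : nat) (beta : R) (H : 'M[C]_d) : 'M[C]_d :=
  (\tr (expmx (- beta%:C *: H)))^-1 *: expmx (- beta%:C *: H).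

Definition l2dist (m : nat) (x y : 'I_m -> R) : R :=
  Num.sqrt (\sum_(a < m) (x a - y a) ^+ 2).

(* A learning procedure using n copies: a joint POVM (outcomes O) on the n
   copies followed by an estimator f.  It succeeds for the Hamiltonian with
   terms E (on nq qubits) at inverse temperature beta and accuracy eps if for
   every admissible coefficient vector the output is eps-close in l2 with
   probability >= 2/3. *)
Definition learns (nq m : nat) (E : 'I_m -> {ffun 'I_nq -> 'I_4}) (beta eps : R)
  (n : nat) (O : finType) (M : O -> 'M[C]_((2 ^ nq) ^ n)) (f : O -> 'I_m -> R)
  : Prop :=
  povm M /\
  forall lam : 'I_m -> R, (forall a, `|lam a| <= 1) ->
    (2%:R / 3%:R : C) <=
      \sum_(o | l2dist (f o) lam <= eps)
         \tr (M o *m (gibbs beta (hamiltonian E lam)) ^t n).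

End QDefs.

(* Main.v *)
Require Import Defs.
From HB Require Import structures.
From mathcomp Require Import all_boot all_order all_algebra.
From mathcomp Require Import all_classical all_reals.
From mathcomp Require Import topology normedtype sequences exp.
From mathcomp Require Import complex mxtens ring lra.
Import Order.TTheory GRing.Theory Num.Theory numFieldNormedType.Exports.
Set Implicit Arguments. Unset Strict Implicit. Unset Printing Implicit Defensive.
Local Open Scope ring_scope.

(**
Group the qubits into [N] pairs and take the terms [Z1], [Z2], [Z1 Z2] on each
pair.  With all three coefficients of a pair equal to [-m], the basis state
[00] has energy [-3m] and the other three have energy [m], so the Gibbs state
is diagonal, a product over pairs, with excited weight of order
[exp (-4 beta m)].  The gap [4m] rather than [2] leaves room to vary [m] in
[{1, 1 - d}] with [d = 10 eps / sqrt N <= 1/10] while keeping the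
distinguishability below [exp (-2 beta)]: writing [D] for the Bhattacharyya
overlap of the two pair distributions,
[1 - D <= 12 beta^2 d^2 exp (-2 beta)].  A measurement of [n] copies of a
diagonal state is a randomized function of [n] classical samples, and learning
in l2 norm to accuracy [eps] recovers most of the bits of a point of the
hypercube [{1, 1 - d}^N].  Assouad's lemma then forces [n (1 - D) >= 1/128].
*)

(** * Assouad's lemma for laws given by amplitudes *)

Section Assouad.
Variable R : realFieldType.

(** Factor [u^2 - v^2 = (u - v)(u + v)] and apply the arithmetic-geometric mean inequality pointwise
    to [t phi (u - v)] and [u + v]. Summing gives [t^2 (2 - 2B) + (2 + 2B)] with [B] the overlap,
    and [B <= 1] bounds the last bracket by 4. The free weight [t] avoids the square root of
    Cauchy-Schwarz. *)
Lemma test_advantage_le (X : finType) (u v phi : X -> R) (t : R) :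
  0 < t -> \sum_x u x ^+ 2 = 1 -> \sum_x v x ^+ 2 = 1 ->
  (forall x, 0 <= phi x <= 1) ->
  \sum_x (u x ^+ 2 - v x ^+ 2) * phi x <=
    t * (1 - \sum_x u x * v x) + 2 / t.
Proof.
move=> t0 u1 v1 phi01; set B := \sum_x u x * v x.
have sqD (s : R) : \sum_x (u x + s * v x) ^+ 2 = 1 + 2 * s * B + s ^+ 2.
  rewrite -[X in _ = X + _ + _]u1 -[s ^+ 2]mulr1 -[X in _ = _ + _ + _ * X]v1.
  rewrite /B !mulr_sumr -!big_split /=.
  by apply: eq_bigr => x _; ring.
have B1 : B <= 1.
  have : 0 <= \sum_x (u x + -1 * v x) ^+ 2.
    by apply: sumr_ge0 => x _; exact: sqr_ge0.
  by rewrite sqD; lra.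
have : 2 * t * \sum_x (u x ^+ 2 - v x ^+ 2) * phi x <=
    t ^+ 2 * \sum_x (u x + -1 * v x) ^+ 2 + \sum_x (u x + 1 * v x) ^+ 2.
  rewrite !mulr_sumr -big_split /=; apply: ler_sum => x _.
  have /andP[p0 p1] := phi01 x.
  have p2 : phi x ^+ 2 <= 1 by rewrite expr_le1.
  have h0 : 0 <= (u x + v x - t * phi x * (u x - v x)) ^+ 2 by exact: sqr_ge0.
  have h1 : 0 <= (1 - phi x ^+ 2) * (t * (u x - v x)) ^+ 2.
    by rewrite mulr_ge0 ?subr_ge0 ?sqr_ge0.
  by lra.
rewrite !sqD => h.
have -> : t * (1 - B) + 2 / t = (t ^+ 2 * (1 - B) + 2) / t by field; lra.
by rewrite ler_pdivlMr//; lra.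
Qed.

Definition flip {N : nat} (j : 'I_N) (b : {ffun 'I_N -> bool}) :=
  [ffun i => b i (+) (i == j)].

Lemma flipK {N : nat} (j : 'I_N) : involutive (flip j).
Proof. by move=> b; apply/ffunP => i; rewrite !ffunE -addbA addbb addbF. Qed.

Lemma flip_id {N : nat} (j : 'I_N) b : flip j b j = ~~ b j.
Proof. by rewrite ffunE eqxx addbT. Qed.

Definition hamming {N : nat} (a b : {ffun 'I_N -> bool}) : nat :=
  #|[pred j | a j != b j]|.

(* [u b x ^+ 2] is the law of the observation under parameter [b], [W] a
   randomized post-processing, [dec] the decoded guess for [b]. *)
Lemma assouad_hamming (N : nat) (X O : finType)
    (u : {ffun 'I_N -> bool} -> X -> R) (W : X -> O -> R)
    (dec : O -> {ffun 'I_N -> bool}) (t kappa : R) :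
  0 < t -> (forall b, \sum_x u b x ^+ 2 = 1) ->
  (forall x o, 0 <= W x o) -> (forall x, \sum_o W x o = 1) ->
  (forall b j, 1 - \sum_x u b x * u (flip j b) x <= kappa) ->
  (2 ^ N * N)%:R * (1 - (t * kappa + 2 / t)) <=
    2 * \sum_b \sum_o (\sum_x W x o * u b x ^+ 2) * (hamming (dec o) b)%:R.
Proof.
move=> t0 u1 W0 W1 hk.
pose err (b : {ffun 'I_N -> bool}) j :=
  \sum_(o | dec o j != b j) \sum_x W x o * u b x ^+ 2.
have -> : \sum_b \sum_o (\sum_x W x o * u b x ^+ 2) * (hamming (dec o) b)%:R
   = \sum_j \sum_b err b j.
  rewrite [RHS]exchange_big /=; apply: eq_bigr => b _.
  rewrite /err [RHS](exchange_big_dep predT)//=; apply: eq_bigr => o _.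
  by rewrite mulr_natr sumr_const.
(* Twice the total error on bit [j] becomes a sum over [b] of the errors at the two neighbours [b]
   and [flip j b], which reduces the claim to two-point testing. *)
have errflip j : \sum_b err b j = \sum_b err (flip j b) j.
  by rewrite (reindex_inj (inv_inj (flipK j))).
have -> : (2 ^ N * N)%:R * (1 - (t * kappa + 2 / t)) =
  \sum_(j < N) \sum_(b : {ffun 'I_N -> bool}) (1 - (t * kappa + 2 / t)).
  by rewrite !sumr_const card_ffun card_bool card_ord -mulrnA mulr_natl.
rewrite mulr_sumr; apply: ler_sum => j _.
rewrite [leRHS]mulr_natl [leRHS]mulr2n [X in _ <= X + _]errflip -big_split /=.
apply: ler_sum => b _.
(* Seen as a test, [phi] accepts when bit [j] is decoded as [b j]. The two errors add up to 1 minus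
   its advantage. *)
pose phi x := \sum_(o | dec o j == b j) W x o.
have -> : err (flip j b) j = \sum_x u (flip j b) x ^+ 2 * phi x.
  rewrite /err exchange_big /=; apply: eq_bigr => x _.
  rewrite /phi mulr_sumr; apply: eq_big => [o|o _]; last by rewrite mulrC.
  by rewrite flip_id; case: (dec o j) (b j) => [] [].
have -> : err b j = 1 - \sum_x u b x ^+ 2 * phi x.
  rewrite -(u1 b) /err exchange_big /= -sumrB; apply: eq_bigr => x _.
  have -> : phi x = 1 - \sum_(o | dec o j != b j) W x o.
    by rewrite -(W1 x) (bigID (fun o => dec o j == b j)) /= addrK.
  by rewrite -mulr_suml; ring.
have phi01 x : 0 <= phi x <= 1.
  rewrite sumr_ge0//= -(W1 x) [leRHS](bigID (fun o => dec o j == b j)) /=.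
  by rewrite lerDl sumr_ge0.
have := test_advantage_le t0 (u1 b) (u1 (flip j b)) phi01.
have -> : \sum_x (u b x ^+ 2 - u (flip j b) x ^+ 2) * phi x =
  \sum_x u b x ^+ 2 * phi x - \sum_x u (flip j b) x ^+ 2 * phi x.
  by rewrite -sumrB; apply: eq_bigr => x _; rewrite mulrBl.
have := ler_wpM2l (ltW t0) (hk b j).
set B := \sum_x u b x * _; set S := \sum_x _ * phi x; set S' := \sum_x _ * phi x.
move: (2 / t) => s; lra.
Qed.

Lemma assouad (N : nat) (X O : finType)
    (u : {ffun 'I_N -> bool} -> X -> R) (W : X -> O -> R)
    (dec : O -> {ffun 'I_N -> bool}) (good : {ffun 'I_N -> bool} -> pred O)
    (kappa : R) :
  (0 < N)%N -> (forall b, \sum_x u b x ^+ 2 = 1) ->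
  (forall x o, 0 <= W x o) -> (forall x, \sum_o W x o = 1) ->
  (forall b j, 1 - \sum_x u b x * u (flip j b) x <= kappa) ->
  (forall b, 2 / 3 <= \sum_(o | good b o) \sum_x W x o * u b x ^+ 2) ->
  (forall b o, good b o -> (hamming (dec o) b)%:R <= N%:R / 25 :> R) ->
  1 / 128 <= kappa.
Proof.
move=> N0 u1 W0 W1 hk hgood hham.
(* With [t = 16] the final inequality reads [16 kappa >= 1 - 1/8 - 56/75 = 77/600], just above
   [16/128 = 75/600]. *)
have := @assouad_hamming N X O u W dec 16 kappa _ u1 W0 W1 hk.
move=> /(_ ltac:(lra)) h.
have Q0 b o : 0 <= \sum_x W x o * u b x ^+ 2.
  by apply: sumr_ge0 => x _; rewrite mulr_ge0 ?sqr_ge0.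
have Q1 b : \sum_o \sum_x W x o * u b x ^+ 2 = 1.
  rewrite exchange_big /= -(u1 b); apply: eq_bigr => x _.
  by rewrite -mulr_suml W1 mul1r.
have NR : 0 <= N%:R :> R by [].
(* A good outcome costs at most [N/25], a bad one at most [N] with probability at most 1/3, and
   [1/25 + 1/3 = 28/75]. *)
have up b : \sum_o (\sum_x W x o * u b x ^+ 2) * (hamming (dec o) b)%:R <=
    N%:R * (28 / 75).
  apply: (@le_trans _ _ (\sum_o (\sum_x W x o * u b x ^+ 2) *
     (N%:R / 25 + (~~ good b o)%:R * N%:R))).
    apply: ler_sum => o _; apply: ler_wpM2l => //.
    have [/hham hb|_] := boolP (good b o); first by rewrite mul0r addr0.
    rewrite mul1r -[leLHS]add0r lerD ?divr_ge0//.
    by rewrite ler_nat /hamming -[leqRHS]card_ord max_card.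
  under eq_bigr do rewrite mulrDr [X in _ + X]mulrA.
  rewrite big_split /= -!mulr_suml Q1.
  have := Q1 b; rewrite (bigID (good b)) /=.
  have -> : \sum_o (\sum_x W x o * u b x ^+ 2) * (~~ good b o)%:R =
     \sum_(o | ~~ good b o) \sum_x W x o * u b x ^+ 2.
    rewrite [RHS]big_mkcond /=; apply: eq_bigr => o _.
    by case: (good b o); rewrite ?mulr1 ?mulr0.
  move=> e; have := hgood b => g; nra.
have : \sum_b \sum_o (\sum_x W x o * u b x ^+ 2) * (hamming (dec o) b)%:R <=
    \sum_(b : {ffun 'I_N -> bool}) N%:R * (28 / 75).
  by apply: ler_sum => b _; exact: up.
rewrite sumr_const card_ffun card_bool card_ord -[leRHS]mulr_natl mulrA -natrM => h2.
have K0 : 0 < (2 ^ N * N)%:R :> R by rewrite ltr0n muln_gt0 expn_gt0.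
have : (2 ^ N * N)%:R * (1 - (16 * kappa + 2 / 16)) <= (2 ^ N * N)%:R * (56/75).
  by apply: le_trans h _; lra.
by rewrite ler_pM2l//; lra.
Qed.
End Assouad.

(** * Diagonal matrices: exponentials, Gibbs states, tensor powers, measurements *)

(** The tensor power of a vector, read off a diagonal matrix so that its entries are indexed exactly
    as those of the matrix power [^t]. *)
Definition tensor_power (R : pzRingType) d (u : 'I_d -> R) n (x : 'I_(d ^ n)) : R :=
  (diag_mx (\row_i u i) ^t n) x x.
Arguments tensor_power {R d} u n x.

Section Diagonal.
Variable R : realType.
Local Notation C := (R[i]).
Local Open Scope complex_scope.

Definition cdiag {d : nat} (p : 'I_d -> R) : 'M[C]_d :=
  diag_mx (\row_i (p i)%:C).

Lemma cdiagE d (p : 'I_d -> R) i j : cdiag p i j = (p i *+ (i == j))%:C.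
Proof. by rewrite !mxE rmorphMn. Qed.

Lemma eq_cdiag d (p q : 'I_d -> R) : p =1 q -> cdiag p = cdiag q.
Proof. by move=> pq; apply/matrixP => i j; rewrite !cdiagE pq. Qed.

Lemma scale_cdiag d (a : R) (p : 'I_d -> R) :
  a%:C *: cdiag p = cdiag (fun i => a * p i).
Proof. by apply/matrixP => i j; rewrite mxE !cdiagE -rmorphM mulrnAr. Qed.

Lemma sum_cdiag d (I : finType) (p : I -> 'I_d -> R) :
  \sum_a cdiag (p a) = cdiag (fun i => \sum_a p a i).
Proof.
apply/matrixP => i j; rewrite summxE cdiagE -sumrMnl rmorph_sum /=.
by apply: eq_bigr => a _; rewrite cdiagE.
Qed.

Lemma mxtrace_cdiag d (p : 'I_d -> R) : \tr (cdiag p) = (\sum_i p i)%:C.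
Proof.
by rewrite /mxtrace rmorph_sum; apply: eq_bigr => i _; rewrite cdiagE eqxx.
Qed.

Lemma exp_cdiag d (p : 'I_d -> R) k :
  cdiag p ^+ k = cdiag (fun i => p i ^+ k).
Proof.
elim: k => [|k IH].
  by apply/matrixP => i j; rewrite cdiagE !mxE rmorphMn.
rewrite exprS IH -mulmxE mul_diag_mx; apply/matrixP => i j.
by rewrite mxE [X in X * _]mxE !cdiagE -rmorphM mulrnAr -exprS.
Qed.

Lemma expmx_cdiag d (p : 'I_d -> R) :
  expmx (cdiag p) = cdiag (fun i => expR (p i)).
Proof.
have partialE K : expmx_partial (cdiag p) K =
    cdiag (fun i => series (exp_coeff (p i)) K).
  rewrite /expmx_partial; under eq_bigr => k _.
    have -> : (k`!%:R)^-1 = ((k`!%:R)^-1 : R)%:C by rewrite fmorphV rmorph_nat.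
    rewrite exp_cdiag scale_cdiag; over.
  rewrite sum_cdiag; apply: eq_cdiag => i.
  by rewrite /series /= big_mkord; apply: eq_bigr => k _; rewrite mulrC.
apply/matrixP => i j; rewrite mxE cdiagE.
under eq_fun do rewrite partialE cdiagE /=.
under [X in _ +i* limn X]eq_fun do rewrite partialE cdiagE /=.
case: (i == j).
  (* The limit of the real parts is [expR] by definition; the imaginary parts are constantly 0. *)
  by congr (_ +i* _); rewrite lim_cst.
by rewrite !mulr0n; congr (_ +i* _); rewrite lim_cst.
Qed.

Lemma gibbs_cdiag d (beta : R) (h : 'I_d -> R) :
  gibbs beta (cdiag h) =
  cdiag (fun i => expR (- beta * h i) / \sum_k expR (- beta * h k)).
Proof.
rewrite /gibbs -rmorphN scale_cdiag expmx_cdiag mxtrace_cdiag.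
rewrite -fmorphV scale_cdiag; apply: eq_cdiag => i.
by rewrite mulrC.
Qed.

Lemma tensor_powerSS d (u : 'I_d -> R) n x :
  tensor_power u n.+2 x = u (@mxtens_unindex d (d ^ n.+1) x).1
    * tensor_power u n.+1 (@mxtens_unindex d (d ^ n.+1) x).2.
Proof. by rewrite /tensor_power ntensmxSS mxE !mxE eqxx. Qed.

Lemma tensor_power_dot d (u v : 'I_d -> R) n :
  \sum_x tensor_power u n x * tensor_power v n x = (\sum_i u i * v i) ^+ n.
Proof.
(* The power [^t 1] is the matrix itself and not a product with a 1 by 1 matrix, so 0 is treated
   apart and the induction starts at 1. *)
case: n => [|n]; first by rewrite big_ord1 /tensor_power !mxE mulr1.
elim: n => [|n IH].
  by rewrite expr1; apply: eq_bigr => x _; rewrite /tensor_power ntensmx1 !mxE eqxx.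
rewrite exprS -IH mulr_sum; apply: eq_bigr => x _.
by rewrite !tensor_powerSS; ring.
Qed.

Lemma tensor_cdiag d (u : 'I_d -> R) n :
  cdiag (fun i => u i ^+ 2) ^t n = cdiag (fun x => tensor_power u n x ^+ 2).
Proof.
case: n => [|n].
  apply/matrixP => i j; rewrite cdiagE /tensor_power !mxE eqxx expr1n.
  by rewrite rmorphMn.
elim: n => [|n IH].
  apply/matrixP => i j; rewrite !cdiagE /tensor_power ntensmx1 !mxE eqxx.
  by rewrite mulr1n.
rewrite ntensmxSS IH; apply/matrixP => i j; rewrite mxE !cdiagE.
rewrite tensor_powerSS exprMn -rmorphM mulrnAl mulrnAr -mulrnA mulnb.
congr ((_ *+ nat_of_bool _)%:C); rewrite andbC -xpair_eqE.
by rewrite (can_eq (@mxtens_unindexK d (d ^ n.+1))).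
Qed.

Lemma psd_diag_ge0 d (A : 'M[C]_d) i : psd A -> 0 <= A i i.
Proof.
case=> _ /(_ (delta_mx i 0)).
suff -> : adjmx (delta_mx i 0 : 'cV[C]_d) = delta_mx 0 i.
  by rewrite -rowE -colE !mxE.
apply/matrixP => k l; rewrite !mxE andbC.
by case: (_ && _); rewrite ?conjc1 ?conjc0.
Qed.

Lemma Re_sum (I : finType) (P : pred I) (F : I -> C) :
  complex.Re (\sum_(i | P i) F i) = \sum_(i | P i) complex.Re (F i).
Proof. exact: (raddf_sum (@complex.Re R : {additive Rcomplex R -> R})). Qed.

(** Together with [povm_diag_sum] this makes the diagonals of a POVM a Markov kernel from basis
    states to outcomes, which is all that a diagonal state sees of the measurement. *)
Lemma povm_diag_ge0 d (O : finType) (M : O -> 'M[C]_d) x o :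
  povm M -> 0 <= complex.Re (M o x x).
Proof. by case=> /(_ o) /(@psd_diag_ge0 _ _ x); rewrite lecE => /andP[]. Qed.

Lemma povm_diag_sum d (O : finType) (M : O -> 'M[C]_d) x :
  povm M -> \sum_o complex.Re (M o x x) = 1.
Proof. by case=> _ M1; rewrite -Re_sum -summxE M1 mxE eqxx. Qed.

Lemma Re_mxtrace_mul_cdiag d (A : 'M[C]_d) (p : 'I_d -> R) :
  complex.Re (\tr (A *m cdiag p)) = \sum_x complex.Re (A x x) * p x.
Proof.
rewrite /mxtrace Re_sum; apply: eq_bigr => x _.
rewrite mul_mx_diag !mxE; case: (A x x) => a b /=.
by rewrite mulr0 subr0.
Qed.
End Diagonal.

(** * Bits of basis indices, qubit pairs and the terms on them *)

Lemma eq_from_bits n r s : (r < 2 ^ n)%N -> (s < 2 ^ n)%N ->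
  (forall k, (k < n)%N -> odd (r %/ 2 ^ k) = odd (s %/ 2 ^ k)) -> r = s.
Proof.
elim: n r s => [|n IH] r s.
  by rewrite expn0 !ltnS !leqn0 => /eqP-> /eqP->.
rewrite expnS => rn sn bits.
have half : (r %/ 2 = s %/ 2)%N.
  apply: IH => [||k kn]; rewrite ?ltn_divLR 1?mulnC// -!divnMA -expnS.
  exact: bits.
have := bits 0%N isT; rewrite !divn1 => odd_eq.
by rewrite -[r]odd_double_half -[s]odd_double_half -!divn2 odd_eq half.
Qed.

Section Pairs.
Variable N : nat.

Lemma pair_qubit_subproof (j : 'I_N) (b : bool) : (2 * j + b < 2 * N)%N.
Proof.
have := ltn_ord j; rewrite -(leq_pmul2l (isT : (0 < 2)%N)) mulnS.
by apply: leq_trans; case: b; rewrite ?addn1 ?addn0 ?add2n.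
Qed.

Definition pair_qubit (p : 'I_N * bool) : 'I_(2 * N) :=
  Ordinal (pair_qubit_subproof p.1 p.2).

Lemma pair_qubit_inj : injective pair_qubit.
Proof.
move=> [i a] [j b] /(congr1 val) /= e.
have ab : a = b by have := congr1 odd e; rewrite !mul2n !oddD !odd_double !oddb.
by move: e; rewrite ab => /addIn /eqP; rewrite eqn_pmul2l// => /eqP /val_inj ->.
Qed.

Definition pair_bits (r : 'I_(2 ^ (2 * N))) : {ffun 'I_N -> bool * bool} :=
  [ffun j => (odd (r %/ 2 ^ pair_qubit (j, false)),
              odd (r %/ 2 ^ pair_qubit (j, true)))].

Lemma pair_bits_bij : bijective pair_bits.
Proof.
apply: inj_card_bij; last first.
  by rewrite card_ffun card_prod card_bool !card_ord expnM.
move=> r s e; apply/val_inj/(eq_from_bits (ltn_ord r) (ltn_ord s)) => k kN.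
(* Qubit [k] belongs to pair [k./2], and its parity tells which of the two it is. *)
have k2 : (k./2 < N)%N by rewrite -divn2 ltn_divLR// mulnC.
have := congr1 (fun g : {ffun 'I_N -> bool * bool} => g (Ordinal k2)) e.
rewrite !ffunE /= addn0 addn1 (mul2n k./2) => -[e0 e1].
by rewrite -(odd_double_half k); case: (odd k); rewrite ?add1n ?add0n.
Qed.

(** Distributivity along the bijection [pair_bits]. It factors both the partition function and the
    overlap of two Gibbs states over the pairs. *)
Lemma sum_prod_pair_bits (R : comPzRingType) (F : 'I_N -> bool * bool -> R) :
  \sum_r \prod_j F j (pair_bits r j) = \prod_j \sum_s F j s.
Proof.
by rewrite bigA_distr_bigA /= (reindex pair_bits)//; exact/onW_bij/pair_bits_bij.
Qed.

(* For the pair [p.1]: [Some b] selects one of its two qubits, [None] both. *)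
Definition term_set (p : 'I_N * option bool) : {set 'I_(2 * N)} :=
  if p.2 is Some b then [set pair_qubit (p.1, b)]
  else [set pair_qubit (p.1, false); pair_qubit (p.1, true)].

Lemma pair_qubit_neq (j : 'I_N) : pair_qubit (j, false) != pair_qubit (j, true).
Proof. by apply/eqP => /pair_qubit_inj. Qed.

Lemma card_term_set p : #|term_set p| = (if p.2 is Some _ then 1 else 2)%N.
Proof.
by case: p => j [b|]; rewrite /term_set /= ?cards1// cards2 pair_qubit_neq.
Qed.

Lemma term_set_inj : injective term_set.
Proof.
(* Cardinality separates one-qubit from two-qubit terms, leaving only the cases of equal type. *)
move=> p q e; have := congr1 (fun S : {set _} => #|S|) e.
rewrite !card_term_set; case: p q e => [i [a|]] [j [b|]]; rewrite /term_set //=.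
  by move=> /set1_inj /pair_qubit_inj [-> ->].
move=> /setP /(_ (pair_qubit (i, false))); rewrite !inE eqxx /=.
by move=> /esym /orP[] /eqP /pair_qubit_inj [->].
Qed.

(** In ['I_4], [ord_max] is the code 3 of Z and 0 is the code of the identity. *)
Definition zstring n (S : {set 'I_n}) : {ffun 'I_n -> 'I_4} :=
  [ffun k => if k \in S then ord_max else 0].

Lemma pauli_support_zstring n (S : {set 'I_n}) : pauli_support (zstring S) = S.
Proof. by apply/setP => k; rewrite inE ffunE; case: (k \in S). Qed.

Lemma zstring_inj n : injective (@zstring n).
Proof.
by move=> S T e; rewrite -(pauli_support_zstring S) e pauli_support_zstring.
Qed.

Definition pair_terms (a : 'I_#|{: 'I_N * option bool}|) :=
  zstring (term_set (enum_val a)).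

Lemma pair_terms_inj : injective pair_terms.
Proof. by move=> a b /zstring_inj /term_set_inj /enum_val_inj. Qed.

Lemma pair_terms_2local a : (0 < #|pauli_support (pair_terms a)| <= 2)%N.
Proof.
by rewrite pauli_support_zstring card_term_set; case: (enum_val a) => ? [].
Qed.

End Pairs.

(** * The pair Hamiltonian and its Gibbs state *)

Section Hamiltonian.
Variable R : realType.
Local Notation C := (R[i]).
Local Open Scope complex_scope.

Lemma pauli_string_zstring n (S : {set 'I_n}) :
  pauli_string R (zstring S) =
  cdiag (fun r => \prod_(k in S) (-1) ^+ odd (r %/ 2 ^ k)).
Proof.
have inord2_eq (a b : bool) :
    (val (inord a : 'I_2) == val (inord b : 'I_2)) = (a == b).
  by rewrite /= !inordK; case: a; case: b.
have entry k r c : pauli1 R (zstring S k) (qbit k r) (qbit k c) =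
   ((if k \in S then (-1) ^+ odd (r %/ 2 ^ k) else 1)
      *+ (odd (r %/ 2 ^ k) == odd (c %/ 2 ^ k)))%:C.
  rewrite mxE /zstring ffunE /qbit.
  case: (k \in S); rewrite /= inord2_eq.
    rewrite inordK; last by case: odd.
    by case: (odd (r %/ _)); case: (odd (c %/ _)); rewrite ?expr1 ?expr0 ?rmorphN.
  by case: eqP.
apply/matrixP => r c; rewrite cdiagE /pauli_string mxE.
under [LHS]eq_bigr do rewrite entry.
have [<-|rc] := eqVneq r c.
  rewrite mulr1n [in RHS]big_mkcond rmorph_prod /=.
  by apply: eq_bigr => k _; rewrite eqxx mulr1n.
(* Distinct indices differ in some bit, and there the factor, I or Z, has a zero off-diagonal
   entry. *)
have [k kP] : exists k : 'I_n, odd (r %/ 2 ^ k) != odd (c %/ 2 ^ k).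
  apply/existsP; apply: contraNT rc; rewrite negb_exists => /forallP rc.
  apply/eqP/val_inj/(eq_from_bits (ltn_ord r) (ltn_ord c)) => k kn.
  by have /negPn/eqP := rc (Ordinal kn).
by rewrite (bigD1 k)//= (negbTE kP) mulr0n rmorph0 mul0r.
Qed.

(** The eigenvalues of [Z1 + Z2 + Z1 Z2]; the coefficients used are negative, so the value 3 belongs
    to the ground state. *)
Definition pair_energy (s : bool * bool) : R :=
  if s == (false, false) then 3 else -1.

Lemma hamiltonian_pair_terms N (mu : 'I_N -> R) :
  hamiltonian (@pair_terms N) (fun a => - mu (enum_val a).1) =
  cdiag (fun r => - \sum_j mu j * pair_energy (pair_bits r j)).
Proof.
rewrite /hamiltonian /pair_terms.
under eq_bigr do rewrite pauli_string_zstring scale_cdiag.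
rewrite sum_cdiag; apply: eq_cdiag => r.
pose F (p : 'I_N * option bool) : R :=
  - mu p.1 * \prod_(k in term_set p) (-1) ^+ odd (r %/ 2 ^ k).
have -> : \sum_(a < #|{: 'I_N * option bool}|) F (enum_val a) = \sum_p F p.
  by apply: esym; apply: reindex; exact/onW_bij/enum_val_bij.
transitivity (\sum_j \sum_t F (j, t)).
  by rewrite pair_big /=; apply: eq_bigr => -[].
rewrite -sumrN; apply: eq_bigr => j _.
rewrite /F /= -mulr_sumr mulNr; congr (- (_ * _)).
rewrite (bigD1 None)//= (bigD1 (Some true))//= (bigD1 (Some false))//=.
rewrite [X in _ + (_ + (_ + X))]big1 ?addr0; last by move=> [[]|].
rewrite /term_set /= !big_set1 big_setU1 ?inE ?pair_qubit_neq//= big_set1.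
rewrite /pair_energy !ffunE /=.
by case: (odd (r %/ _)); case: (odd (r %/ _));
  rewrite ?eqxx ?expr1 ?expr0 /=; lra.
Qed.

(** * Amplitudes of one pair and their overlap *)

Section Amplitude.
Variable beta : R.

Definition pair_Z (m : R) := \sum_s expR (beta * m * pair_energy s).

(** The square root of a Gibbs probability, so that inner products are Bhattacharyya overlaps. *)
Definition pair_amp (m : R) s :=
  expR (beta * m * pair_energy s / 2) / Num.sqrt (pair_Z m).

Lemma pair_Z_gt0 m : 0 < pair_Z m.
Proof.
rewrite /pair_Z (bigD1 (false, false))//= ltr_wpDr ?expR_gt0//.
by apply: sumr_ge0 => s _; exact: expR_ge0.
Qed.

Lemma pair_amp_sqr m s :
  pair_amp m s ^+ 2 = expR (beta * m * pair_energy s) / pair_Z m.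
Proof.
rewrite /pair_amp expr_div_n sqr_sqrtr ?ltW ?pair_Z_gt0//.
by rewrite -expRM_natl; congr (expR _ / _); field.
Qed.

Lemma pair_amp_norm m : \sum_s pair_amp m s * pair_amp m s = 1.
Proof.
under eq_bigr do rewrite -expr2 pair_amp_sqr.
by rewrite -mulr_suml divff// gt_eqF ?pair_Z_gt0.
Qed.

Definition gibbs_amp N (mu : 'I_N -> R) (r : 'I_(2 ^ (2 * N))) :=
  \prod_j pair_amp (mu j) (pair_bits r j).

Lemma gibbs_amp_dot N (mu nu : 'I_N -> R) :
  \sum_r gibbs_amp mu r * gibbs_amp nu r =
  \prod_j \sum_s pair_amp (mu j) s * pair_amp (nu j) s.
Proof.
rewrite -sum_prod_pair_bits; apply: eq_bigr => r _.
by rewrite /gibbs_amp -big_split.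
Qed.

Lemma gibbs_pair_terms N (mu : 'I_N -> R) :
  gibbs beta (hamiltonian (@pair_terms N) (fun a => - mu (enum_val a).1)) =
  cdiag (fun r => gibbs_amp mu r ^+ 2).
Proof.
rewrite hamiltonian_pair_terms gibbs_cdiag; apply: eq_cdiag => r.
have weight k :
    expR (- beta * - (\sum_j mu j * pair_energy (pair_bits k j))) =
    \prod_j expR (beta * mu j * pair_energy (pair_bits k j)).
  rewrite -expR_sum mulrNN mulr_sumr; congr expR.
  by apply: eq_bigr => j _; rewrite mulrA.
under [X in _ / X]eq_bigr do rewrite weight.
rewrite weight (sum_prod_pair_bits (fun j s => expR (beta * mu j * pair_energy s))).
rewrite -prodf_div /gibbs_amp -prodrXl.
by apply: eq_bigr => j _; rewrite pair_amp_sqr.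
Qed.

Lemma pair_amp_overlap d : 0 < beta -> 0 <= d <= 1 / 10 ->
  let D := \sum_s pair_amp 1 s * pair_amp (1 - d) s in
  [/\ 0 <= D, D <= 1 & 1 - D <= 12 * beta ^+ 2 * d ^+ 2 * expR (- (2 * beta))].
Proof.
move=> b0 /andP[d0 d1] D.
(* Unnormalized amplitudes of the ground state and of each of the three excited states. *)
pose p m := expR (3 * beta * m / 2); pose q m := expR (- (beta * m) / 2).
have p0 m : 0 < p m by exact: expR_gt0.
have q0 m : 0 < q m by exact: expR_gt0.
have sum_pairs (F : bool * bool -> R) : \sum_s F s =
    F (false, false) + F (false, true) + F (true, false) + F (true, true).
  transitivity (\sum_a \sum_b F (a, b)); last by rewrite !big_bool /=; ring.
  by rewrite pair_big /=; apply: eq_bigr => -[].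
have ZE m : pair_Z m = p m ^+ 2 + 3 * q m ^+ 2.
  rewrite /pair_Z sum_pairs /pair_energy /=.
  rewrite /p /q -!expRM_natl.
  have -> : 2%:R * (3 * beta * m / 2) = beta * m * 3 by field.
  have -> : 2%:R * (- (beta * m) / 2) = beta * m * -1 by field.
  ring.
have Z0 := pair_Z_gt0.
set m := 1 - d in D *.
have DE : D = (p 1 * p m + 3 * (q 1 * q m)) / Num.sqrt (pair_Z 1 * pair_Z m).
  rewrite sqrtrM ?ltW// /D sum_pairs /pair_amp /pair_energy /= /p /q -!expRD.
  have -> : 3 * beta * 1 / 2 + 3 * beta * m / 2 =
      beta * 1 * 3 / 2 + beta * m * 3 / 2 by field.
  have -> : - (beta * 1) / 2 + - (beta * m) / 2 =
      beta * 1 * -1 / 2 + beta * m * -1 / 2 by field.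
  rewrite !expRD; field.
  by rewrite !gt_eqF ?sqrtr_gt0.
have ZZ0 : 0 < pair_Z 1 * pair_Z m by rewrite mulr_gt0.
have D0 : 0 <= D.
  by rewrite DE divr_ge0 ?sqrtr_ge0// addr_ge0 ?mulr_ge0 ?ltW.
(* Lagrange's identity for the vectors [(p, q, q, q)] at 1 and at [m]: only the pairings of [p] with
   a [q] survive, three times. *)
have gapE : 1 - D ^+ 2 =
    3 * (p 1 * q m - p m * q 1) ^+ 2 / (pair_Z 1 * pair_Z m).
  rewrite DE expr_div_n sqr_sqrtr ?ltW//; apply: (mulIf (lt0r_neq0 ZZ0)).
  by rewrite mulrBl !divfK ?gt_eqF// mul1r !ZE; ring.
have D1 : D <= 1.
  rewrite -(@ler_pXn2r _ 2)// ?nnegrE// expr1n -subr_ge0 gapE.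
  by rewrite divr_ge0 ?(ltW ZZ0)// mulr_ge0 ?sqr_ge0.
split=> //.
apply: (@le_trans _ _ (1 - D ^+ 2)); first by nra.
(* The bound [pair_Z m >= p m ^+ 2] leaves only the ratios [q / p], which are pure exponentials. *)
have gap2 : 1 - D ^+ 2 <= 3 * (q m / p m - q 1 / p 1) ^+ 2.
  rewrite gapE ler_pdivrMr//.
  have -> : 3 * (p 1 * q m - p m * q 1) ^+ 2 =
      3 * (q m / p m - q 1 / p 1) ^+ 2 * (p 1 ^+ 2 * p m ^+ 2).
    by field; rewrite !gt_eqF.
  apply: ler_wpM2l; first by rewrite mulr_ge0 ?sqr_ge0.
  by rewrite !ZE; apply: ler_pM; rewrite ?sqr_ge0// lerDl mulr_ge0 ?sqr_ge0.
apply: (le_trans gap2).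
have ratio x : q x / p x = expR (- (2 * beta * x)).
  by rewrite /p /q -expRB; congr expR; field.
rewrite !ratio.
have -> : expR (- (2 * beta * 1)) = expR (- (2 * beta * m)) * expR (- (2 * beta * d)).
  by rewrite -expRD /m; congr expR; ring.
have e1 : 1 - 2 * beta * d <= expR (- (2 * beta * d)) by exact: expR_ge1Dx.
have bd0 : 0 <= 2 * beta * d by rewrite !mulr_ge0// ltW.
have e2 : expR (- (2 * beta * d)) <= 1 by rewrite expR_le1 oppr_le0.
(* The exponent on the left is [4 beta (1 - d)], and [d <= 1/10] keeps it above [2 beta]. *)
have e3 : expR (- (2 * beta * m)) ^+ 2 <= expR (- (2 * beta)).
  by rewrite -expRM_natl ler_expR /m; nra.
have -> : 3 * (expR (- (2 * beta * m)) -
    expR (- (2 * beta * m)) * expR (- (2 * beta * d))) ^+ 2 =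
  3 * ((1 - expR (- (2 * beta * d))) ^+ 2 * expR (- (2 * beta * m)) ^+ 2) by ring.
have -> : 12 * beta ^+ 2 * d ^+ 2 * expR (- (2 * beta)) =
  3 * ((2 * beta * d) ^+ 2 * expR (- (2 * beta))) by ring.
rewrite ler_pM2l//; apply: ler_pM; rewrite ?sqr_ge0//.
by rewrite ler_pXn2r ?nnegrE//; lra.
Qed.

End Amplitude.
End Hamiltonian.

(** * From many copies and l2 error to the sample bound *)

Lemma bernoulli_pow_le (R : realFieldType) (D : R) n :
  0 <= D -> D <= 1 -> 1 - D ^+ n <= n%:R * (1 - D).
Proof.
move=> D0 D1; elim: n => [|n IH]; first by rewrite expr0 subrr mul0r.
have Dn : D ^+ n <= 1 by rewrite exprn_ile1.
rewrite exprSr -natr1 mulrDl mul1r; nra.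
Qed.

(** Each wrong bit costs [d / 2] in a coordinate of its own, since [idx] is injective, hence
    [d^2 / 4] in squared distance. *)
Lemma hamming_le_l2dist (R : realType) N m (idx : 'I_N -> 'I_m)
    (g lam : 'I_m -> R) (d eps : R) (a b : {ffun 'I_N -> bool}) :
  injective idx -> 0 <= d -> 0 <= eps -> l2dist g lam <= eps ->
  (forall j, a j != b j -> d / 2 <= `|g (idx j) - lam (idx j)|) ->
  (hamming a b)%:R * (d ^+ 2 / 4) <= eps ^+ 2.
Proof.
move=> idx_inj d0 e0 ge sep.
have sum0 : 0 <= \sum_k (g k - lam k) ^+ 2.
  by apply: sumr_ge0 => k _; exact: sqr_ge0.
apply: (@le_trans _ _ (\sum_k (g k - lam k) ^+ 2)); last first.
  by rewrite -[leLHS]sqr_sqrtr// ler_pXn2r ?nnegrE ?sqrtr_ge0.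
apply: (@le_trans _ _ (\sum_j (g (idx j) - lam (idx j)) ^+ 2)).
  rewrite mulr_natl -sumr_const big_mkcond /=; apply: ler_sum => j _.
  case: ifP => [/sep sj|_]; last exact: sqr_ge0.
  rewrite -[leRHS]real_normK ?num_real//.
  have -> : d ^+ 2 / 4 = (d / 2) ^+ 2 by field.
  by rewrite ler_pXn2r ?nnegrE// divr_ge0.
rewrite -(big_imset (fun k => (g k - lam k) ^+ 2) (in2W idx_inj)) /=.
rewrite [leRHS](bigID (mem (idx @: 'I_N))) /= lerDl.
by apply: sumr_ge0 => k _; exact: sqr_ge0.
Qed.

Theorem theorem5p4 (R : realType) :
  exists c : R, 0 < c /\
  forall (beta : R) (N : nat) (eps : R),
    0 < beta -> 0 < eps -> eps <= (100%:R)^-1 * Num.sqrt (N%:R) ->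
    exists (m : nat) (E : 'I_m -> {ffun 'I_(2 * N) -> 'I_4}),
      injective E /\
      (forall a, (0 < #|pauli_support (E a)| <= 2)%N) /\
      forall (n : nat) (O : finType) (M : O -> 'M[R[i]]_((2 ^ (2 * N)) ^ n))
             (f : O -> 'I_m -> R),
        learns E beta eps M f ->
        c * expR (2%:R * beta) * N%:R / (beta ^+ 2 * eps ^+ 2) <= n%:R.
Proof.
(* The 128 comes from [assouad]; 1200 is the 12 of [pair_amp_overlap] times the 100 in
   [d^2 = 100 eps^2 / N]. *)
exists (128^-1 / 1200); split; first by rewrite divr_gt0 ?invr_gt0 ?ltr0n.
move=> beta N eps b0 e0 eN.
exists #|{: 'I_N * option bool}|, (@pair_terms N); split.
  exact: pair_terms_inj.
split=> [|n O M f [povmM learnM]]; first exact: pair_terms_2local.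
have N0 : (0 < N)%N.
  by rewrite lt0n; apply/eqP => N0; move: eN; rewrite N0 sqrtr0 mulr0; lra.
have NR : 0 < N%:R :> R by rewrite ltr0n.
have sN0 : 0 < Num.sqrt N%:R :> R by rewrite sqrtr_gt0.
(* With the factor 10, the bound on [eps] gives [d <= 1/10], and [hamming * d^2 / 4 <= eps^2]
   becomes [hamming <= N / 25]. *)
pose d := 10 * eps / Num.sqrt N%:R.
have d0 : 0 < d by rewrite divr_gt0// mulr_gt0.
have d1 : d <= 1 / 10 by rewrite ler_pdivrMr//; lra.
have d2 : d ^+ 2 = 100 * eps ^+ 2 / N%:R.
  by rewrite /d expr_div_n sqr_sqrtr ?ltW// exprMn; congr (_ * _ / _); ring.
pose mu (b : {ffun 'I_N -> bool}) j := 1 - d *+ b j.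
pose lam b (a : 'I_#|{: 'I_N * option bool}|) := - mu b (enum_val a).1.
(* The three coefficients of a pair coincide, so the bit is decoded from one of them, that of
   [Z1 Z2], by a threshold midway between [-1] and [-(1 - d)]. *)
pose idx j : 'I_#|{: 'I_N * option bool}| := enum_rank (j, None).
pose dec o : {ffun 'I_N -> bool} := [ffun j => - (1 - d / 2) < f o (idx j)].
pose u b := tensor_power (gibbs_amp beta (mu b)) n.
pose W x o := complex.Re (M o x x).
have [D0 D1 Dle] := @pair_amp_overlap R beta d b0 ltac:(lra).
set D := \sum_s _ in D0 D1 Dle.
(* Every pair other than [j] contributes a normalized factor 1. *)
have Dflip b j : \sum_r gibbs_amp beta (mu b) r * gibbs_amp beta (mu (flip j b)) r = D.
  rewrite gibbs_amp_dot (bigD1 j)//= [X in _ * X]big1 ?mulr1 => [|i ij].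
    rewrite /mu flip_id; case: (b j); rewrite /= ?mulr1n ?mulr0n subr0//.
    by apply: eq_bigr => s _; rewrite mulrC.
  by rewrite /mu ffunE (negbTE ij) addbF pair_amp_norm.
have u1 b : \sum_x u b x ^+ 2 = 1.
  under eq_bigr do rewrite expr2.
  rewrite tensor_power_dot gibbs_amp_dot big1 ?expr1n// => j _.
  exact: pair_amp_norm.
have : 1 / 128 <= n%:R * (12 * beta ^+ 2 * d ^+ 2 * expR (- (2 * beta))) :> R.
  apply: (@assouad _ N _ O u W dec (fun b o => l2dist (f o) (lam b) <= eps)) => //.
  - by move=> x o; exact: povm_diag_ge0.
  - by move=> x; exact: povm_diag_sum.
  (* The overlap of [n] copies is [D ^+ n]; Bernoulli's inequality turns its deficit into
     [n (1 - D)], which is how the number of samples enters. *)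
  - move=> b j; rewrite tensor_power_dot Dflip.
    by apply: le_trans (bernoulli_pow_le n D0 D1) _; rewrite ler_wpM2l.
  - move=> b; have lam1 a : `|lam b a| <= 1.
      rewrite normrN ler_norml /mu; case: (b _); rewrite ?mulr1n ?mulr0n; lra.
    have := learnM (lam b) lam1; rewrite gibbs_pair_terms tensor_cdiag.
    rewrite lecE => /andP[_]; rewrite Re_sum.
    under eq_bigr do rewrite Re_mxtrace_mul_cdiag.
    apply: le_trans.
    have -> : (2%:R / 3%:R : R[i]) = real_complex R (2 / 3).
      by rewrite fmorph_div !rmorph_nat.
    by [].
  - move=> b o good.
    have idx_inj : injective idx by move=> i j /enum_rank_inj [].
    have := @hamming_le_l2dist R N _ idx (f o) (lam b) d eps (dec o) b
      idx_inj (ltW d0) (ltW e0) good.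
    have sep j : dec o j != b j -> d / 2 <= `|f o (idx j) - lam b (idx j)|.
      rewrite ffunE /lam /mu enum_rankK /= => dj; rewrite ler_normr; apply/orP.
      case: ltP dj => dj; case: (b j) => // _; rewrite ?mulr1n ?mulr0n.
        by left; lra.
      by right; lra.
    move=> /(_ sep); rewrite d2 => h.
    have {h} h : (hamming (dec o) b)%:R * 25 / N%:R <= 1 :> R.
      rewrite -(ler_pM2r (exprn_gt0 2 e0)) mul1r; apply: le_trans h.
      by rewrite le_eqVlt; apply/orP; left; apply/eqP; field; rewrite gt_eqF.
    by rewrite ler_pdivrMr// in h; lra.
rewrite d2 expRN => h.
have X0 : 0 < expR (2 * beta) by exact: expR_gt0.
have be0 : 0 < beta ^+ 2 * eps ^+ 2 by rewrite mulr_gt0 ?exprn_gt0.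
rewrite ler_pdivrMr//.
(* Multiplying by [exp (2 beta) N] clears the denominators on the right. *)
have {h} := ler_wpM2r (ltW (mulr_gt0 X0 NR)) h.
have -> : n%:R * (12 * beta ^+ 2 * (100 * eps ^+ 2 / N%:R) / expR (2 * beta)) *
    (expR (2 * beta) * N%:R) = 1200 * (n%:R * (beta ^+ 2 * eps ^+ 2)).
  by field; rewrite !gt_eqF.
lra.
Qed.
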